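(* Let $K,N\in\mathbb{N}$, let $\mathcal{A}_1,\dots,\mathcal{A}_K\subseteq[N]$ be arbitrary access sets, and let $\mathcal{C}$ be the capacity region of the distributed multi-user secret sharing (DMUSS) problem with $N$ storage nodes, $K$ users, and access sets $\mathcal{A}_1,\dots,\mathcal{A}_K$ (as defined in the context). Then $\mathcal{C}$ is equal to the convex hull of the set of all tuples $(R_1,\dots,R_K)$ of nonnegative real numbers satisfying $$R_k\le \min_{\tilde k\in[K],\,\tilde k\neq k}|\mathcal{A}_k\setminus\mathcal{A}_{\tilde k}|\quad\text{for all }k\in[K],$$ $$\sum_{i\in\mathcal{S}}R_i\le\Big|\bigcup_{i\in\mathcal{S}}\mathcal{A}_i\Big|\quad\text{for all }\mathcal{S}\subseteq[K].$$
   Context: Notation: $[n]=\{1,\dots,n\}$; for $\mathcal{I}\subseteq[N]$, $Y_{\mathcal{I}}=(Y_n)_{n\in\mathcal{I}}$. Fix a prime power $q$; all entropies are Shannon entropies with logarithms to base $q$. A minimum over an empty set is $+\infty$ (so for $K=1$ the first family of constraints is vacuous). DMUSS scheme with storage size $M$. Let $M\in\mathbb{N}$, let $\mathbb{F}=\mathbf{GF}(q^M)$, and let $r_1,\dots,r_K$ be nonnegative integers (message lengths in $q$-ary symbols). The messages $W_1,\dots,W_K$ are mutually independent, and $W_k$ is uniformly distributed over a set of size $q^{r_k}$, so $H(W_k)=r_k$. The rate of the $k$-th message is $r_k/M$. A scheme consists of: (i) an encoder (placement) at the master node, which maps $(W_1,\dots,W_K)$, possibly using private randomness independent of the messages, to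 $(Y_1,\dots,Y_N)\in\mathbb{F}^N$, where $Y_n$ (equivalently $M$ $q$-ary symbols) is the content of storage node $n$; (ii) for each user $k\in[K]$, a decoder (retrieval) that maps $Y_{\mathcal{A}_k}$ to an estimate $\hat W_k$ of $W_k$. Conditions on a sequence of schemes indexed by $M=1,2,\dots$: Correctness: for every $k\in[K]$, $\Pr(W_k\neq\hat W_k)\to0$ as $M\to\infty$. Privacy: for every $M$ and all $k,\tilde k\in[K]$ with $k\neq\tilde k$, $H(W_{\tilde k}\mid Y_{\mathcal{A}_k})=H(W_{\tilde k})$. A tuple $(R_1,\dots,R_K)$ of nonnegative reals is achievable if there is a sequence of DMUSS schemes indexed by the storage size $M=1,2,\dots$ satisfying correctness and privacy, whose message lengths $r_k^{(M)}$ satisfy $r_k^{(M)}/M\to R_k$ for every $k\in[K]$. The capacity region $\mathcal{C}$ is the closure of the set of achievable rate tuples. *)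

(* Defs.v *)
From HB Require Import structures.
From mathcomp Require Import all_boot all_order all_algebra.
From mathcomp Require Import all_classical all_reals all_analysis.
Set Implicit Arguments.
Unset Strict Implicit.
Unset Printing Implicit Defensive.
Import Order.TTheory GRing.Theory Num.Theory.
Import numFieldNormedType.Exports.
Local Open Scope classical_set_scope.
Local Open Scope ring_scope.

Definition is_prime_power (q : nat) : Prop :=
  exists p e : nat, [/\ prime p, (0 < e)%N & q = (p ^ e)%N].

(* Measurability of a random variable with values in a finite (discrete) type;
   such types carry no canonical sigma-algebra in the library. *)
Definition discrete_rv d (Omega : measurableType d) (T : finType)
    (X : Omega -> T) : Prop :=
  forall x : T, measurable (X @^-1` [set x]).

Definition law d (Omega : measurableType d) (R : realType)
    (P : probability Omega R) (T : Type) (X : Omega -> T) (x : T) : R :=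
  fine (P (X @^-1` [set x])).

Definition logb (R : realType) (q : nat) (x : R) : R := ln x / ln q%:R.

(* Since [0 * _ = 0], terms of probability 0 contribute 0. *)
Definition entropy_of (R : realType) (q : nat) (T : finType) (p : T -> R) : R :=
  - \sum_(x : T) p x * logb q (p x).

Definition entropy d (Omega : measurableType d) (R : realType) (q : nat)
    (P : probability Omega R) (T : finType) (X : Omega -> T) : R :=
  entropy_of q (law P X).

(* H(X | Y) = sum_y P(Y = y) H(X | Y = y); the summands with P(Y = y) = 0
   vanish, whatever value the division by 0 gives to the conditional law. *)
Definition cond_entropy d (Omega : measurableType d) (R : realType) (q : nat)
    (P : probability Omega R) (T U : finType)
    (X : Omega -> T) (Y : Omega -> U) : R :=
  \sum_(y : U) law P Y y *
    entropy_of q (fun x : T => law P (fun o => (X o, Y o)) (x, y) / law P Y y).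

Definition mutually_independent d (Omega : measurableType d) (R : realType)
    (P : probability Omega R) (K : nat) (T : 'I_K -> finType)
    (X : forall k : 'I_K, Omega -> T k) : Prop :=
  forall x : (forall k : 'I_K, T k),
    law P (fun o => X ^~ o) x = \prod_(k < K) law P (X k) (x k).

Definition independent_of_messages d (Omega : measurableType d) (R : realType)
    (P : probability Omega R) (K : nat) (T : 'I_K -> finType)
    (X : forall k : 'I_K, Omega -> T k)
    d' (S : measurableType d') (Z : Omega -> S) : Prop :=
  forall (x : forall k : 'I_K, T k) (B : set S), measurable B ->
    P ([set o | X ^~ o = x] `&` Z @^-1` B) =
    (P [set o | X ^~ o = x] * P (Z @^-1` B))%E.

(* A scheme of storage size M, with users 'I_K, storage nodes 'I_N and access
   sets A, together with the probability space carrying its randomness. The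
   private randomness [seed] of the master node is an arbitrary random
   variable. *)
Record dmuss_scheme (R : realType) (q M K N : nat)
    (A : 'I_K -> {set 'I_N}) := DmussScheme {
  node : finFieldType;
  card_node : #|node| = (q ^ M)%N;
  msg_len : 'I_K -> nat;
  msg : 'I_K -> finType;
  card_msg : forall k, #|msg k| = (q ^ msg_len k)%N;

  omega_display : measure_display;
  omega : measurableType omega_display;
  pr : probability omega R;

  message : forall k, omega -> msg k;
  message_rv : forall k, discrete_rv (message k);
  message_uniform : forall k w, law pr (message k) w = #|msg k|%:R^-1;
  message_indep : mutually_independent pr message;

  seed_display : measure_display;
  seed_space : measurableType seed_display;
  seed : omega -> seed_space;
  seed_rv : measurable_fun setT seed;
  seed_indep : independent_of_messages pr message seed;

  encode : (forall k, msg k) -> seed_space -> {ffun 'I_N -> node};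
  encode_rv : forall w, discrete_rv (encode w);

  decode : forall k, {ffun {n : 'I_N | n \in A k} -> node} -> msg k
}.
Arguments encode {R q M K N A} _ w z.
Arguments decode {R q M K N A} _ k y.
Arguments message {R q M K N A} _ k o.
Arguments seed {R q M K N A} _ o.

Definition storage (R : realType) (q M K N : nat) (A : 'I_K -> {set 'I_N})
    (s : dmuss_scheme R q M A) (o : omega s) : {ffun 'I_N -> node s} :=
  encode s (message s ^~ o) (seed s o).

Definition accessed (R : realType) (q M K N : nat) (A : 'I_K -> {set 'I_N})
    (s : dmuss_scheme R q M A) (k : 'I_K) (o : omega s) :
    {ffun {n : 'I_N | n \in A k} -> node s} :=
  [ffun n => storage o (val n)].

Definition estimate (R : realType) (q M K N : nat) (A : 'I_K -> {set 'I_N})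
    (s : dmuss_scheme R q M A) (k : 'I_K) (o : omega s) : msg s k :=
  decode s k (accessed k o).

Definition is_private (R : realType) (q M K N : nat) (A : 'I_K -> {set 'I_N})
    (s : dmuss_scheme R q M A) : Prop :=
  forall k k' : 'I_K, k != k' ->
    cond_entropy q (pr s) (message s k') (accessed (s := s) k) =
    entropy q (pr s) (message s k').

(* The storage sizes M = 1, 2, ... are written m.+1 with m : nat. *)
Definition achievable (R : realType) (q K N : nat) (A : 'I_K -> {set 'I_N})
    (r : 'rV[R]_K) : Prop :=
  (forall k, 0 <= r 0 k) /\
  exists s : forall m : nat, dmuss_scheme R q m.+1 A,
    [/\ forall k, pr (s m) [set o | message (s m) k o <> estimate k o]
          @[m --> \oo] --> 0%E,
        forall m, is_private (s m)
      & forall k, ((msg_len (s m) k)%:R / m.+1%:R : R) @[m --> \oo] --> r 0 k].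

Definition capacity_region (R : realType) (q K N : nat)
    (A : 'I_K -> {set 'I_N}) : set 'rV[R]_K :=
  closure [set r : 'rV[R]_K | achievable q A r].

Definition convex_hull (R : realType) (E : lmodType R) (X : set E) : set E :=
  smallest (@convex_set R E) X.

(* [\big[Order.min/+oo]] over an empty range is [+oo]. *)
Definition rate_constraints (R : realType) (K N : nat)
    (A : 'I_K -> {set 'I_N}) : set 'rV[R]_K :=
  [set r : 'rV[R]_K | [/\ forall k, 0 <= r 0 k,
      forall k, ((r 0 k)%:E <=
        \big[Order.min/+oo]_(k' < K | k' != k) (#|A k :\: A k'|%:R)%:E)%E
    & forall S : {set 'I_K},
        \sum_(i in S) r 0 i <= #|(\bigcup_(i in S) A i)%SET|%:R]].

(* Main.v *)
(** Converse: the storage read by a coalition S takes at most q^(M |U A_i|)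
    values, so the uniform messages of S are guessed from it with probability at
    most q^(M |U A_i| - sum r_i), and this must tend to 1. Privacy makes W_k
    uniform given Y_(A_k'), as equality in the entropy bound forces a uniform
    conditional law; hence W_k is guessed from Y_(A_k) with probability at most
    q^(M |A_k \ A_k'| - r_k).

    Achievability: split each node into T symbols of a field
    E = GF(q^L), L = M %/ T, and let rho_k = floor (T R_k). The storage Y is uniform
    and W_k = Y G_k for matrices G_k supported on the coordinates of A_k.
    The scheme is well defined when the columns of all G_k are jointly independent,
    and private when the columns of G_k stay independent after deleting the
    coordinates of A_k'. Each of these conditions is satisfiable separately (the
    first by Hall's theorem) and open, so a generic choice satisfies all of them
    as soon as E is large, i.e. for M large and T fixed. The constraints define a
    convex set, so the convex hull adds nothing; T tending to infinity and closure
    give all of it. *)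

Require Import Defs.
From HB Require Import structures.
From mathcomp Require Import all_boot all_order all_algebra.
From mathcomp Require Import all_classical all_reals all_analysis.
From mathcomp Require Import finfield zify ring lra.
Set Implicit Arguments.
Unset Strict Implicit.
Unset Printing Implicit Defensive.
Import Defs.
Import Order.TTheory GRing.Theory Num.Theory.
Import numFieldNormedType.Exports.
Local Open Scope ring_scope.

(** * Generic linear codes *)

(* Rado's proof: if an edge can be removed from a set with two elements
   x, y neither way, the submodularity of the union cardinality is violated. *)
Lemma hall_marriage (I V : finType) (F : I -> {set V}) :
  (forall J : {set I}, (#|J| <= #|(\bigcup_(i in J) F i)%SET|)%N) ->
  exists2 phi : I -> V, injective phi & forall i, phi i \in F i.
Proof.
move: {2}(\sum_i #|F i|)%N (leqnn (\sum_i #|F i|)%N) => n.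
elim: n F => [|n IH] F leFn hallF.
  have FE i : #|F i| = 0%N.
    by apply/eqP; rewrite -leqn0 (leq_trans _ leFn)// (bigD1 i)//= leq_addr.
  have I0 (i : I) : False.
    by have := hallF [set i]; rewrite cards1 big_set1 FE.
  have /fin_all_exists[phi _] : forall i : I, exists v : V, True by move=> /I0.
  by exists phi => i; case: (I0 i).
have [/forallP small|/forallPn[i]] := boolP [forall i, (#|F i| <= 1)%N].
  have /fin_all_exists[phi phiF] : forall i, exists v, v \in F i.
    move=> i; apply/finset.set0Pn; rewrite -card_gt0.
    by have := hallF [set i]; rewrite cards1 big_set1.
  exists phi => // i j eq_phi; apply/eqP/negPn/negP => neq_ij.
  have := hallF [set i; j]; rewrite cards2 neq_ij leqNgt => /negP; apply.
  rewrite ltnS; apply: (@leq_trans #|[set phi i]|); last by rewrite cards1.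
  rewrite fintype.subset_leq_card//; apply/fintype.subsetP => v.
  have F1 k u : u \in F k -> u = phi k.
    by move=> uF; exact: (card_le1_eqP (small k)).
  case/bigcupP => k; rewrite !inE => /orP[]/eqP-> /F1->//.
  by rewrite eq_phi.
rewrite -ltnNge => /card_gt1P[x [y [xF yF neq_xy]]].
pose F' z j := if j == i then F i :\ z else F j.
have F'F z j : F' z j \subset F j.
  by rewrite /F'; case: eqP => [->|_//]; exact: subsetDl.
have leF' z : z \in F i -> (\sum_j #|F' z j| <= n)%N.
  move=> zF; rewrite -ltnS (leq_trans _ leFn)// (bigD1 i)//=.
  rewrite (bigD1 i (F := fun j => #|F j|))//=.
  rewrite /F' eqxx (cardsD1 z (F i)) zF -addSn leq_add//.
  by apply: leq_sum => j /negPf->.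
have done_by z : z \in F i ->
    [forall J : {set I}, (#|J| <= #|(\bigcup_(j in J) F' z j)%SET|)%N] ->
    exists2 phi : I -> V, injective phi & forall j, phi j \in F j.
  move=> zF /forallP hallF'; have [phi inj_phi phiF] := IH _ (leF' z zF) hallF'.
  by exists phi => // j; exact: (fintype.subsetP (F'F z j)).
have [/(done_by x xF)//|/forallPn[J]] :=
  boolP [forall J : {set I}, (#|J| <= #|(\bigcup_(j in J) F' x j)%SET|)%N].
rewrite -ltnNge => ltJ.
have [/(done_by y yF)//|/forallPn[L]] :=
  boolP [forall J : {set I}, (#|J| <= #|(\bigcup_(j in J) F' y j)%SET|)%N].
rewrite -ltnNge => ltL.
(* [F'] differs from [F] only at [i], so a set that violates Hall's condition must contain [i]. *)
have i_in z (S : {set I}) : (#|(\bigcup_(j in S) F' z j)%SET| < #|S|)%N -> i \in S.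
  apply: contraLR => iS; rewrite -leqNgt (leq_trans (hallF S))//.
  rewrite fintype.subset_leq_card//; apply/fintype.subsetP => v /bigcupP[j jS vF].
  apply/bigcupP; exists j => //; rewrite /F'; case: eqP => // ji.
  by rewrite -ji jS in iS.
have [iJ iL] := (i_in _ _ ltJ, i_in _ _ ltL).
set P := (\bigcup_(j in J) F' x j)%SET in ltJ *.
set Q := (\bigcup_(j in L) F' y j)%SET in ltL *.
(* As [x != y], the two reduced copies of [F i] together cover [F i]. With [leI] this gives |P| +
   |Q| >= |J| + |L| - 1, whereas [ltJ] and [ltL] allow at most |J| + |L| - 2. *)
have leU : (#|J :|: L| <= #|P :|: Q|)%N.
  apply: leq_trans (hallF _) _; rewrite fintype.subset_leq_card//.
  apply/fintype.subsetP => v /bigcupP[j jJL vF]; rewrite inE.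
  have [eq_ji|neq_ji] := eqVneq j i; last first.
    move: jJL; rewrite inE => /orP[jS|jS]; apply/orP; [left|right];
      by apply/bigcupP; exists j; rewrite // /F' (negPf neq_ji).
  rewrite eq_ji in vF; have [eq_vx|neq_vx] := eqVneq v x; apply/orP.
    by right; apply/bigcupP; exists i; rewrite // /F' eqxx !inE vF eq_vx neq_xy.
  by left; apply/bigcupP; exists i; rewrite // /F' eqxx !inE vF neq_vx.
have leI : (#|(J :&: L) :\ i| <= #|P :&: Q|)%N.
  apply: leq_trans (hallF _) _; rewrite fintype.subset_leq_card//.
  apply/fintype.subsetP => v /bigcupP[j]; rewrite !inE => /and3P[/negPf neq_ji jJ jL] vF.
  by apply/andP; split; apply/bigcupP; exists j; rewrite // /F' neq_ji.
have := leq_add leU leI; have := cardsUI P Q; have := cardsUI J L.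
rewrite (cardsD1 i (J :&: L)) inE iJ iL /=; move: ltJ ltL.
lia.
Qed.

(** The determinant is a polynomial in [t], of degree at most [m] by the Leibniz expansion, and
    nonzero because its value at [t0] is 1. So invertibility fails for at most [m] parameters of a
    line, which is the openness used in [generic_point]. *)
Lemma unitmx_line (E : fieldType) (m n : nat) (X : 'M[E]_(m, n))
    (A B : 'M[E]_(n, m)) (t0 : E) :
  X *m (A + t0 *: B) = 1%:M ->
  exists p : {poly E}, [/\ p != 0, (size p <= m.+1)%N &
    forall t, p.[t] != 0 -> X *m (A + t *: B) \in unitmx].
Proof.
move=> XAB1.
pose M := map_mx polyC (X *m A) + 'X *: map_mx polyC (X *m B).
have detM t : (\det M).[t] = \det (X *m (A + t *: B)).
  rewrite -[LHS]/(horner_eval t (\det M)) -det_map_mx; congr (\det _).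
  apply/matrixP => i j; rewrite mulmxDr -scalemxAr /M.
  move: (X *m A) (X *m B) => P Q; rewrite !mxE /= /horner_eval.
  by rewrite !hornerE.
exists (\det M); split.
- apply/eqP => M0; have := detM t0; rewrite M0 horner0 XAB1 det1 => /eqP.
  by rewrite eq_sym oner_eq0.
- apply: leq_trans (size_sum _ _ _) _; apply/bigmax_leqP => s _.
  rewrite -(rmorph_sign (@polyC E)) mul_polyC (leq_trans (size_scale_leq _ _))//.
  apply: leq_trans (size_prod_leq _ _) _; rewrite card_ord leq_subLR.
  rewrite (@leq_trans (\sum_(i < m) 2).+1)//; last by rewrite sum_nat_const card_ord; lia.
  rewrite ltnS leq_sum// => i _; rewrite /M.
  move: (X *m A) (X *m B) => P Q; rewrite !mxE.
  rewrite (leq_trans (size_polyD _ _))// geq_max (leq_trans (size_polyC_leq1 _))//=.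
  by rewrite mulrC (leq_trans (size_polyMleq _ _))// size_polyX addn2 ltnS size_polyC_leq1.
- by move=> t; rewrite detM unitmxE unitfE.
Qed.

Lemma poly_nonroot (E : finFieldType) (p : {poly E}) :
  p != 0 -> (size p <= #|E|)%N -> exists t, p.[t] != 0.
Proof.
move=> p0 szp; have [/existsP//|/existsPn rootp] := boolP [exists t, p.[t] != 0].
have := max_poly_roots p0 (rs := enum E).
rewrite enum_uniq -cardE ltnNge szp => /(_ _ isT) H.
by have := H (introT allP (fun t _ => negbNE (rootp t))).
Qed.

(* Joining two points by a line, each open condition that holds at one of them
   fails for at most [d] parameters. *)
Lemma generic_point (E : finFieldType) (T : Type) (I : eqType) (line : T -> T -> E -> T)
    (L : T -> Prop) (C : I -> T -> Prop) (d : nat) (a0 : T) :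
  (forall a b, line a b 0 = a) -> (forall a b, line a b 1 = b) ->
  (forall a b t, L a -> L b -> L (line a b t)) ->
  (forall i a b t0, C i (line a b t0) -> exists p : {poly E},
     [/\ p != 0, (size p <= d.+1)%N & forall t, p.[t] != 0 -> C i (line a b t)]) ->
  (forall i, exists2 a, L a & C i a) -> L a0 ->
  forall s : seq I, (d * size s < #|E|)%N ->
  exists2 a, L a & forall i, i \in s -> C i a.
Proof.
move=> line0 line1 Lline Copen Cwit La0; elim=> [|i s IH] szs; first by exists a0.
have [|a La Ca] := IH; first by rewrite (leq_ltn_trans _ szs)// leq_mul2l leqnSn orbT.
have [b Lb Cb] := Cwit i.
(* The old conditions hold at [t = 0] and the new one at [t = 1]. The product of their polynomials
   has degree at most [d * (size s).+1], less than [#|E|], so some parameter avoids all roots. *)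
have [p [p0 szp pC]] : exists p : {poly E}, [/\ p != 0, (size p <= (d * size s).+1)%N &
    forall t, p.[t] != 0 -> forall j, j \in s -> C j (line a b t)].
  elim: s Ca {IH szs} => [|j s IHs] Ca.
    by exists 1; rewrite oner_neq0 size_poly1 muln0.
  have [|p [p0 szp pC]] := IHs; first by move=> k ks; apply: Ca; rewrite inE ks orbT.
  have [|p' [p0' szp' pC']] := Copen j a b 0.
    by rewrite line0; apply: Ca; rewrite mem_head.
  exists (p * p'); split; first by rewrite mulf_neq0.
    rewrite (leq_trans (size_polyMleq _ _))//= mulnS.
    move: szp szp'; move: (size p) (size p') (d * size s)%N => x y z.
    by lia.
  move=> t; rewrite hornerM mulf_eq0 negb_or => /andP[pt pt'] k.
  by rewrite inE => /orP[/eqP->|]; [exact: pC'|exact: pC].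
have [|p' [p0' szp' pC']] := Copen i a b 1; first by rewrite line1.
have [||t] := @poly_nonroot E (p * p'); first by rewrite mulf_neq0.
  rewrite (leq_trans (size_polyMleq _ _))//.
  by move: szs szp szp'; rewrite /= mulnS; lia.
rewrite hornerM mulf_eq0 negb_or => /andP[pt pt'].
exists (line a b t); first exact: Lline.
by move=> k; rewrite inE => /orP[/eqP->|]; [exact: pC'|exact: pC].
Qed.

(* The content [Y : 'rV_n] of the storage is read by user k through [Y *m G k],
   which only involves the coordinates in [B k]; [H] is a joint right inverse
   of these maps. *)
Definition secret_sharing_code (E : fieldType) (K n : nat)
    (B : 'I_K -> {set 'I_n}) (rho : 'I_K -> nat)
    (G : forall k, 'M[E]_(n, rho k)) (H : forall k, 'M[E]_(rho k, n)) : Prop :=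
  [/\ forall k v j, v \notin B k -> G k v j = 0,
      forall k, H k *m G k = 1%:M,
      forall k k', k != k' -> H k *m G k' = 0
    & forall k k', k != k' -> exists2 X : 'M[E]_(rho k, n),
        forall j v, v \in B k' -> X j v = 0 & X *m G k = 1%:M].

(** There is one joint decodability condition and one privacy condition per ordered pair of users.
    Their number and the degrees of their polynomials depend only on [K] and [rho], so one threshold
    [c] serves every field. *)
Lemma generic_code (K n : nat) (B : 'I_K -> {set 'I_n}) (rho : 'I_K -> nat) :
  (forall k k', k != k' -> (rho k <= #|B k :\: B k'|)%N) ->
  (forall S : {set 'I_K}, (\sum_(k in S) rho k <= #|(\bigcup_(k in S) B k)%SET|)%N) ->
  exists c : nat, forall E : finFieldType, (c < #|E|)%N ->
    exists (G : forall k, 'M[E]_(n, rho k)) (H : forall k, 'M[E]_(rho k, n)),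
      secret_sharing_code B G H.
Proof.
move=> privB sumB.
pose I : finType := {k : 'I_K & 'I_(rho k)}.
have [phi inj_phi phiB] : exists2 phi : I -> 'I_n, injective phi &
    forall i, phi i \in B (tag i).
  (* Hall's condition for a set [J] of message symbols follows from the sum constraint for the set
     [S] of users owning them. *)
  apply: hall_marriage => J; pose S := [set tag i | i in J]%SET.
  apply: leq_trans (leq_trans _ (sumB S)) _; last first.
    rewrite fintype.subset_leq_card//; apply/bigcupsP => k /imsetP[i iJ ->].
    by apply/fintype.subsetP => v vB; apply/bigcupP; exists i.
  rewrite -sum1_card (partition_big (@tag _ _) (mem S)) /=; last first.
    by move=> i iJ; apply: imset_f.
  apply: leq_sum => k _; rewrite sum1_card -[X in (_ <= X)%N](card_ord (rho k)).
  rewrite -(card_imset predT (f := fun j : 'I_(rho k) => Tagged (fun k => 'I_(rho k)) j : I)).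
    rewrite fintype.subset_leq_card//; apply/fintype.subsetP => -[k' j].
    rewrite unfold_in /= => /andP[_ /eqP ek].
    by case: _ / ek; apply: imset_f.
  by move=> j j' /eqP; rewrite eq_Tagged => /eqP.
(* [#|I|] bounds the degree for decodability, [rho k] that for privacy. In the index type, [None]
   stands for decodability and [Some (k, k')] for hiding message [k] from user [k']. *)
pose d := (#|I| + \sum_k rho k)%N.
exists (d * #|{: option ('I_K * 'I_K)}|)%N => E ltE.
pose fam := forall k, 'M[E]_(n, rho k).
pose all_cols (G : fam) : 'M[E]_(n, #|I|) :=
  \matrix_(v, c) G (tag (enum_val c)) v (tagged (enum_val c)).
pose line (a b : fam) (t : E) : fam := fun k => a k + t *: (b k - a k).
pose L (G : fam) := forall k v j, v \notin B k -> G k v j = 0.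
pose Cpriv k k' (G : fam) := k != k' -> exists2 X : 'M[E]_(rho k, n),
        forall j v, v \in B k' -> X j v = 0 & X *m G k = 1%:M.
pose Cdec (G : fam) := exists X : 'M[E]_(#|I|, n), X *m all_cols G = 1%:M.
pose C (o : option ('I_K * 'I_K)) : fam -> Prop :=
  if o is Some kk' then Cpriv kk'.1 kk'.2 else Cdec.
have all_lineE a b t : all_cols (line a b t) = all_cols a + t *: (all_cols b - all_cols a).
  by apply/matrixP => v c; rewrite !mxE.
have [|||||||G LG CG] := @generic_point E fam _ line L C d (fun k => 0) _ _ _ _ _ _
    (enum {: option ('I_K * 'I_K)}) _.
- by move=> a b; apply: functional_extensionality_dep => k; rewrite /line scale0r addr0.
- by move=> a b; apply: functional_extensionality_dep => k; rewrite /line scale1r addrC subrK.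
- move=> a b t La Lb k v j vB; rewrite !mxE La// Lb//.
  by rewrite subr0 mulr0 addr0.
- case=> [[k k']|] a b t0 /=.
    rewrite /Cpriv; have [_ _|neq_kk' /(_ isT)[X X0]] := eqVneq k k'.
      by exists 1; rewrite oner_neq0 size_poly1.
    move=> /unitmx_line[p [p0 szp pX]]; exists p; split=> //.
      by rewrite (leq_trans szp)// ltnS /d (bigD1 k)//= addnCA leq_addr.
    (* The inverse acts on the left, so the zero columns of [X] stay zero. *)
    move=> t /pX XU _; exists (invmx (X *m line a b t k) *m X);
      last by rewrite -mulmxA mulVmx.
    by move=> j v vB; rewrite !mxE big1// => i _; rewrite X0 ?mulr0.
  move=> [X]; rewrite all_lineE => /unitmx_line[p [p0 szp pX]]; exists p; split=> //.
    by rewrite (leq_trans szp)// ltnS leq_addr.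
  move=> t /pX XU; exists (invmx (X *m all_cols (line a b t)) *m X).
  by rewrite -mulmxA mulVmx// all_lineE.
- case=> [[k k']|] /=.
    (* Witness for privacy: column [j] of [W i] is the unit vector at the [j]-th coordinate of [B i]
       outside [B k'], or zero if there is none. For [i = k] there are enough such coordinates by
       [privB]. *)
    pose Ds i := enum (B i :\: B k').
    pose W i : 'M[E]_(n, rho i) :=
      \matrix_(v, j) ((v \in B i :\: B k') && (index v (Ds i) == j))%:R.
    exists W; first by move=> i v j vB; rewrite mxE !inE (negPf vB) andbF.
    move=> neq_kk'; exists (W k)^T => [j v vB|]; first by rewrite !mxE !inE vB.
    apply/matrixP => i j; rewrite !mxE.
    have ltD (l : 'I_(rho k)) : (l < size (Ds k))%N.
      by rewrite -cardE (leq_trans (ltn_ord l))// privB.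
    have [v0 _] : exists v0, v0 \in Ds k.
      by exists (tnth (in_tuple (Ds k)) (Ordinal (ltD i))); exact: mem_tnth.
    pose v := nth v0 (Ds k) i.
    have vD : v \in B k :\: B k' by rewrite -mem_enum mem_nth.
    have idxv : index v (Ds k) = i by rewrite index_uniq ?enum_uniq ?ltD.
    rewrite (bigD1 v)//= big1 ?addr0 => [|u neq_uv]; rewrite !mxE.
      by rewrite vD idxv /= eqxx mul1r.
    case uD: (u \in _) => /=; last by rewrite mul0r.
    case: eqP => [idxu|]; last by rewrite mul0r.
    case/eqP: neq_uv; rewrite /v -idxu nth_index//.
    by rewrite mem_enum.
  (* Witness for decodability: each message symbol is stored in plain at the coordinate that Hall's
     theorem assigns to it. *)
  pose W i : 'M[E]_(n, rho i) :=
    \matrix_(v, j) (v == phi (Tagged (fun k => 'I_(rho k)) j))%:R.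
  exists W.
    move=> i v j vB; rewrite mxE; case: eqP => // ev.
    by rewrite ev (phiB (Tagged (fun k => 'I_(rho k)) j)) in vB.
  exists (all_cols W)^T; apply/matrixP => i j; rewrite !mxE.
  have WE v c : all_cols W v c = (v == phi (enum_val c))%:R.
    by rewrite !mxE; case: (enum_val c).
  rewrite (bigD1 (phi (enum_val i)))//= big1 ?addr0 => [|v neq_v]; rewrite mxE !WE.
    by rewrite eqxx mul1r (inj_eq inj_phi) (inj_eq enum_val_inj).
  by rewrite (negPf neq_v) mul0r.
- by move=> k v j _; rewrite mxE.
- by rewrite -cardE.
have [X XG] : Cdec G by apply: (CG None); rewrite mem_enum.
pose H k : 'M[E]_(rho k, n) :=
  \matrix_(j, v) X (enum_rank (Tagged (fun k => 'I_(rho k)) j : I)) v.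
have HG k k' j j' : (H k *m G k') j j' =
    (Tagged (fun k => 'I_(rho k)) j == Tagged (fun k => 'I_(rho k)) j' :> I)%:R.
  transitivity ((X *m all_cols G) (enum_rank (Tagged (fun k => 'I_(rho k)) j : I))
     (enum_rank (Tagged (fun k => 'I_(rho k)) j' : I))).
    by rewrite !mxE; apply: eq_bigr => v _; rewrite !mxE enum_rankK.
  by rewrite XG mxE (inj_eq enum_rank_inj).
exists G, H; split=> //.
- by move=> k; apply/matrixP => j j'; rewrite HG eq_Tagged mxE.
- move=> k k' neq_kk'; apply/matrixP => j j'; rewrite HG mxE.
  by case: eqP => // /(congr1 (@tag _ _))/= ek; rewrite ek eqxx in neq_kk'.
- by move=> k k'; apply: (CG (Some (k, k'))); rewrite mem_enum.
Qed.

Local Open Scope classical_set_scope.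

(** * Finite random variables and entropy *)

Lemma discrete_rv_measurable d (Omega : measurableType d) (T : finType)
    (X : Omega -> T) (S : set T) :
  discrete_rv X -> measurable (X @^-1` S).
Proof.
move=> mX; have -> : X @^-1` S = \bigcup_(x in S) (X @^-1` [set x]).
  apply/seteqP; split => [z Sz|z [x Sx /= Xz]]; first by exists (X z).
  by rewrite /preimage /= Xz.
by apply: fin_bigcup_measurable => //; exact: finite_finset.
Qed.

Lemma law_ge0 d (Omega : measurableType d) (R : realType)
    (P : probability Omega R) (T : Type) (X : Omega -> T) (x : T) :
  0 <= law P X x.
Proof. exact/fine_ge0/measure_ge0. Qed.

Lemma prob_pred d (Omega : measurableType d) (R : realType)
    (P : probability Omega R) (T : finType) (X : Omega -> T) (S : pred T) :
  discrete_rv X ->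
  P [set o | S (X o)] = (\sum_(x | S x) law P X x)%:E.
Proof.
move=> mX.
have H s : uniq s -> P [set o | X o \in s] = (\sum_(x <- s) law P X x)%:E.
  elim: s => [_|x s IH /= /andP[xs us]].
    by rewrite big_nil (_ : [set o | _] = set0) ?measure0//; apply/seteqP; split.
  rewrite big_cons EFinD -IH// /law fineK; last first.
    by rewrite fin_num_measure//; exact: mX.
  rewrite -measureU//.
  - congr (P _); apply/seteqP; split => [z|z] /=; rewrite inE.
      by move=> /orP[/eqP->|]; [left|right].
    by move=> [->|->]; rewrite ?eqxx ?orbT.
  - exact: (discrete_rv_measurable [set x | x \in s] mX).
  - by apply/seteqP; split => // o [/= ->]; rewrite (negPf xs).
rewrite big_mkcond -big_mkcond /= -big_enum /= -H ?enum_uniq//.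
by congr (P _); apply/seteqP; split => o /=; rewrite mem_enum.
Qed.

Lemma law_comp d (Omega : measurableType d) (R : realType)
    (P : probability Omega R) (T : finType) (X : Omega -> T)
    (U : eqType) (f : T -> U) (u : U) :
  discrete_rv X ->
  law P (f \o X) u = \sum_(x | f x == u) law P X x.
Proof.
move=> mX; rewrite {1}/law (_ : _ @^-1` _ = [set o | f (X o) == u]); last first.
  by apply/seteqP; split => o /= /eqP.
by rewrite (prob_pred P (fun x => f x == u)).
Qed.

Lemma sum_law d (Omega : measurableType d) (R : realType)
    (P : probability Omega R) (T : finType) (X : Omega -> T) :
  discrete_rv X -> \sum_x law P X x = 1.
Proof.
move=> mX; apply: EFin_inj; rewrite -(prob_pred P predT mX).
by rewrite (_ : [set o | _] = setT) ?probability_setT//; apply/seteqP; split.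
Qed.

(* Given [f], the guess can only take [#|V|] forms, one per value of [g], and
   each is right with conditional probability at most [c]. *)
Lemma guess_bound (R : realType) (T U V : finType) (p : T -> R)
    (f : T -> U) (g : T -> V) (D : U -> V -> pred T) (c : R) :
  (forall x, 0 <= p x) -> \sum_x p x = 1 ->
  (forall u v, \sum_(x | (f x == u) && D u v x) p x <=
               c * \sum_(x | f x == u) p x) ->
  \sum_(x | D (f x) (g x) x) p x <= c * #|V|%:R.
Proof.
move=> p0 p1 pc; rewrite (partition_big (fun x => (f x, g x)) predT)//=.
apply: (@le_trans _ _ (\sum_(uv : U * V) c * \sum_(x | f x == uv.1) p x)).
  apply: ler_sum => -[u v] _ /=; apply: le_trans (pc u v).
  rewrite big_mkcond [leRHS]big_mkcond; apply: ler_sum => x _ /=.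
  rewrite xpair_eqE; case: eqP => [->|_] /=; last by rewrite andbF.
  case: eqP => [->|_] /=; first by rewrite andbT.
  by rewrite andbF; case: ifP.
rewrite -(pair_bigA _ (fun u _ => c * \sum_(x | f x == u) p x)) /=.
under eq_bigr do rewrite sumr_const -mulrnAr.
rewrite -mulr_sumr sumrMnl.
have -> : \sum_u \sum_(x | f x == u) p x = 1.
  by rewrite -p1 [RHS](partition_big f predT).
by [].
Qed.

(** For positive [x] this is e^y > 1 + y at y = - ln x. Strictness away from 1 is what yields the
    equality case of the entropy bound. *)
Lemma xlnx_gt (R : realType) (x : R) : 0 <= x -> x != 1 -> x - 1 < x * ln x.
Proof.
rewrite le_eqVlt => /orP[/eqP<- _|x0 x1]; first by rewrite mul0r sub0r oppr_lt0.
have /expR_gt1Dx : - ln x != 0 by rewrite oppr_eq0 ln_eq0.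
rewrite expRN lnK ?posrE// -(ltr_pM2l x0) divff ?gt_eqF// mulrBr mulr1.
by rewrite ltrBlDr -ltrBlDl.
Qed.

Lemma xlnx_ge (R : realType) (x : R) : 0 <= x -> x - 1 <= x * ln x.
Proof.
move=> x0; have [->|/(xlnx_gt x0)/ltW//] := eqVneq x 1.
by rewrite ln1 mulr0 subrr.
Qed.

(* The deficit is a sum of terms [y ln y - (y - 1)], which vanish only at
   [y = 1]. *)
Lemma entropy_deficit (R : realType) (q : nat) (T : finType) (p : T -> R) :
  (0 < #|T|)%N -> (forall x, 0 <= p x) -> \sum_x p x = 1 ->
  entropy_of q p = logb q (#|T|%:R) - (#|T|%:R * ln q%:R)^-1 *
    \sum_x (#|T|%:R * p x * ln (#|T|%:R * p x) - (#|T|%:R * p x - 1)).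
Proof.
move=> T0 p0 p1; have n0 : 0 < #|T|%:R :> R by rewrite ltr0n.
have lnE x : #|T|%:R * p x * ln (#|T|%:R * p x) =
    #|T|%:R * ln #|T|%:R * p x + #|T|%:R * (p x * ln (p x)).
  have [->|px0] := eqVneq (p x) 0; first by rewrite !(mul0r, mulr0) addr0.
  by rewrite lnM ?posrE// ?lt_neqAle 1?eq_sym ?px0 ?p0//; ring.
under [in RHS]eq_bigr do rewrite lnE.
rewrite sumrB big_split sumrB /= -!mulr_sumr p1 sumr_const !mulr1 subrr subr0.
rewrite /entropy_of /logb; under eq_bigr do rewrite mulrA.
rewrite -mulr_suml invfM; set S := \sum_x _.
move: (ln q%:R)^-1 => l; move: #|T|%:R n0 => n n0; move: (ln n) => m.
by field; rewrite gt_eqF.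
Qed.

Lemma entropy_uniform (R : realType) (q : nat) (T : finType) :
  (0 < #|T|)%N -> entropy_of q (fun _ : T => #|T|%:R^-1 : R) = logb q #|T|%:R.
Proof.
move=> T0; have n0 : 0 < #|T|%:R :> R by rewrite ltr0n.
rewrite /entropy_of sumr_const -mulrnAl -mulr_natr mulVf ?gt_eqF// mul1r.
by rewrite /logb lnV ?posrE// mulNr opprK.
Qed.

(** The gap to the maximal entropy is an average over [y] of nonnegative deficits. If the gap is
    zero, every deficit of positive weight vanishes, and each of its summands sits at its only
    zero. *)
Lemma cond_entropy_max_uniform (R : realType) (q : nat) (T U : finType)
    (pj : T * U -> R) (pu : U -> R) :
  (1 < q)%N -> (0 < #|T|)%N -> (forall z, 0 <= pj z) ->
  (forall y, pu y = \sum_x pj (x, y)) -> \sum_y pu y = 1 ->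
  \sum_y pu y * entropy_of q (fun x => pj (x, y) / pu y) = logb q #|T|%:R ->
  forall x y, pj (x, y) = pu y / #|T|%:R.
Proof.
move=> q1 T0 pj0 puE pu1 maxH x y.
have n0 : 0 < #|T|%:R :> R by rewrite ltr0n.
have lq : 0 < ln q%:R :> R by rewrite ln_gt0// ltr1n.
have pu0 u : 0 <= pu u by rewrite puE sumr_ge0.
have [py0|py0] := eqVneq (pu y) 0.
  rewrite py0 mul0r; move: py0; rewrite puE => /psumr_eq0P -> //.
pose delta u t := #|T|%:R * (pj (t, u) / pu u) * ln (#|T|%:R * (pj (t, u) / pu u)) -
  (#|T|%:R * (pj (t, u) / pu u) - 1).
have delta0 u t : 0 <= delta u t.
  by rewrite subr_ge0 xlnx_ge// mulr_ge0 ?divr_ge0 ?(ltW n0).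
have HE u : pu u * entropy_of q (fun x => pj (x, u) / pu u) =
    pu u * logb q #|T|%:R - (#|T|%:R * ln q%:R)^-1 * (pu u * \sum_t delta u t).
  have [->|pun0] := eqVneq (pu u) 0; first by rewrite !(mul0r, mulr0) subr0.
  rewrite entropy_deficit//; first by rewrite mulrBr; congr (_ - _); rewrite mulrCA.
    by move=> t /=; rewrite divr_ge0.
  by rewrite -mulr_suml -puE divff.
have /eqP : (#|T|%:R * ln q%:R)^-1 * \sum_u pu u * \sum_t delta u t = 0 :> R.
  move: maxH; under eq_bigr do rewrite HE.
  rewrite sumrB -mulr_suml pu1 mul1r mulr_sumr => /eqP.
  by rewrite -[X in _ == X -> _]subr0 (inj_eq (addrI _)) eqr_opp => /eqP.
rewrite mulf_eq0 invr_eq0 mulf_eq0 (gt_eqF n0) (gt_eqF lq) /= => /eqP/psumr_eq0P H.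
have {H} /eqP : pu y * \sum_t delta y t = 0.
  by apply: H => // u _; rewrite mulr_ge0// sumr_ge0.
rewrite mulf_eq0 (negPf py0) /= => /eqP/psumr_eq0P H.
have {H} : delta y x = 0 by apply: H.
have [H _|neq1 /eqP] := eqVneq (#|T|%:R * (pj (x, y) / pu y)) 1; last first.
  rewrite subr_eq0 => /eqP eqx.
  have := xlnx_gt (mulr_ge0 (ltW n0) (divr_ge0 (pj0 (x, y)) (pu0 y))) neq1.
  by rewrite eqx ltxx.
have /eqP : pj (x, y) / pu y = #|T|%:R^-1.
  by apply: (mulfI (lt0r_neq0 n0)); rewrite divff ?gt_eqF.
by rewrite -(inj_eq (mulIf py0)) divfK// mulrC => /eqP.
Qed.

Lemma cond_entropy_uniform (R : realType) (q : nat) (T U : finType)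
    (pj : T * U -> R) (pu : U -> R) :
  (0 < #|T|)%N -> \sum_y pu y = 1 ->
  (forall x y, pj (x, y) = pu y / #|T|%:R) ->
  \sum_y pu y * entropy_of q (fun x => pj (x, y) / pu y) = logb q #|T|%:R.
Proof.
move=> T0 pu1 pjE; transitivity (\sum_y pu y * logb q (#|T|%:R : R)); last first.
  by rewrite -mulr_suml pu1 mul1r.
apply: eq_bigr => y _.
have [->|py0] := eqVneq (pu y) 0; first by rewrite !mul0r.
rewrite -[in RHS](entropy_uniform R q T0); congr (_ * entropy_of q _).
by apply/funext => x; rewrite pjE mulrAC divff// mul1r.
Qed.

(** * Converse *)

Definition restr (N : nat) (F : Type) (S : {set 'I_N}) (y : {ffun 'I_N -> F}) :
    {ffun {n : 'I_N | n \in S} -> F} :=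
  [ffun n => y (val n)].

(** The default 0 never matters: a coordinate outside [S] is either not read or meets a zero row of
    a code matrix. *)
Definition extend (N : nat) (F : zmodType) (S : {set 'I_N})
    (y : {ffun {n : 'I_N | n \in S} -> F}) (n : 'I_N) : F :=
  if insub n is Some v then y v else 0.

Lemma extend_restr (N : nat) (F : zmodType) (S : {set 'I_N})
    (y : {ffun 'I_N -> F}) (n : 'I_N) :
  n \in S -> extend (restr S y) n = y n.
Proof. by move=> nS; rewrite /extend insubT ffunE. Qed.

Lemma card_restr (N : nat) (F : finType) (S : {set 'I_N}) :
  #|{ffun {n : 'I_N | n \in S} -> F}| = (#|F| ^ #|S|)%N.
Proof. by rewrite card_ffun card_sig. Qed.

(** The sample space and the seed are arbitrary, but the events of the converse depend only on
    messages and storage, hence on this finite type. *)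
Definition outcomes (R : realType) (q M K N : nat) (A : 'I_K -> {set 'I_N})
    (s : dmuss_scheme R q M A) : finType :=
  ({dffun forall k : 'I_K, msg s k} * {ffun 'I_N -> node s})%type.

Definition outcome (R : realType) (q M K N : nat) (A : 'I_K -> {set 'I_N})
    (s : dmuss_scheme R q M A) (o : omega s) : outcomes s :=
  ([ffun k => message s k o], storage o).

Lemma messageE (R : realType) (q M K N : nat) (A : 'I_K -> {set 'I_N})
    (s : dmuss_scheme R q M A) (k : 'I_K) :
  message s k = (fun x : outcomes s => x.1 k) \o @outcome _ _ _ _ _ _ s.
Proof. by apply/funext => o; rewrite /= ffunE. Qed.

(** [encode] is measurable in the seed for each fixed tuple of messages, so the event is split into
    fixing the messages, a finite intersection, and an event on the seed alone. *)
Lemma outcome_rv (R : realType) (q M K N : nat) (A : 'I_K -> {set 'I_N})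
    (s : dmuss_scheme R q M A) : discrete_rv (@outcome _ _ _ _ _ _ s).
Proof.
move=> -[w y]; rewrite (_ : _ @^-1` _ =
    (\bigcap_(k in [set: 'I_K]) (message s k @^-1` [set w k])) `&`
    seed s @^-1` (encode s w @^-1` [set y])).
  apply: measurableI; last first.
    rewrite -[X in measurable X]setTI; apply: (@seed_rv _ _ _ _ _ _ s) => //.
    exact: encode_rv.
  apply: fin_bigcap_measurable; first exact: finite_finset.
  by move=> k _; exact: message_rv.
apply/seteqP; split => z /=.
  move=> [wE yE]; split=> [k _|] /=; first by rewrite -wE ffunE.
  rewrite -yE /storage; congr (encode s _ _); apply: functional_extensionality_dep => k.
  by rewrite -wE ffunE.
move=> [wE yE]; rewrite /outcome; congr pair.
  by apply/ffunP => k; rewrite ffunE; exact: wE.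
rewrite -yE /storage; congr (encode s _ _); apply: functional_extensionality_dep => k.
exact: wE.
Qed.

Definition decodes (R : realType) (q M K N : nat) (A : 'I_K -> {set 'I_N})
    (s : dmuss_scheme R q M A) (k : 'I_K)
    (x : outcomes s) : bool :=
  x.1 k == decode s k (restr (A k) x.2).

Lemma prob_error (R : realType) (q M K N : nat) (A : 'I_K -> {set 'I_N})
    (s : dmuss_scheme R q M A) (k : 'I_K) :
  pr s [set o | message s k o <> estimate k o] =
  (\sum_(x | ~~ decodes k x) law (pr s) (@outcome _ _ _ _ _ _ s) x)%:E.
Proof.
rewrite -(prob_pred _ (fun x : outcomes s => ~~ decodes k x) (@outcome_rv _ _ _ _ _ _ s)).
by congr (pr s _); apply/seteqP; split => z /=;
  rewrite /decodes /= ffunE => /eqP.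
Qed.

Lemma card_msg_gt0 (R : realType) (q M K N : nat) (A : 'I_K -> {set 'I_N})
    (s : dmuss_scheme R q M A) (k : 'I_K) :
  (0 < q)%N -> (0 < #|msg s k|)%N.
Proof. by move=> q0; rewrite card_msg expn_gt0 q0. Qed.

Lemma entropy_message (R : realType) (q M K N : nat) (A : 'I_K -> {set 'I_N})
    (s : dmuss_scheme R q M A) (k : 'I_K) :
  (0 < q)%N -> entropy q (pr s) (message s k) = logb q #|msg s k|%:R.
Proof.
move=> q0; rewrite -entropy_uniform ?card_msg_gt0// /entropy.
by congr entropy_of; apply/funext => w; rewrite message_uniform.
Qed.

(** A uniform message has the largest possible entropy, so privacy is the equality case of the bound
    on conditional entropy. *)
Lemma private_law (R : realType) (q M K N : nat) (A : 'I_K -> {set 'I_N})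
    (s : dmuss_scheme R q M A) (k k' : 'I_K) :
  (1 < q)%N -> is_private s -> k != k' -> forall w u,
  \sum_(x : outcomes s | (restr (A k) x.2 == u) && (x.1 k' == w))
     law (pr s) (@outcome _ _ _ _ _ _ s) x =
  (\sum_(x : outcomes s | restr (A k) x.2 == u) law (pr s) (@outcome _ _ _ _ _ _ s) x) /
    #|msg s k'|%:R.
Proof.
move=> q1 /[apply]; have q0 := ltnW q1; rewrite entropy_message// => H w u.
set p := law _ _; have mX := @outcome_rv _ _ _ _ _ _ s.
have pjE z : law (pr s) (fun o => (message s k' o, accessed k o)) z =
    \sum_(x : outcomes s | (x.1 k', restr (A k) x.2) == z) p x.
  rewrite -(law_comp _ _ _ mX); congr law; apply/funext => o.
  by rewrite /= messageE.
have puE y : law (pr s) (accessed (s := s) k) y =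
    \sum_(x : outcomes s | restr (A k) x.2 == y) p x.
  exact: (law_comp (pr s) (fun x : outcomes s => restr (A k) x.2) y mX).
have p0 x : 0 <= p x by exact: law_ge0.
have := cond_entropy_max_uniform q1 (card_msg_gt0 s k' q0) _ _ _ H w u.
rewrite pjE puE (eq_bigl (fun x : outcomes s => (restr (A k) x.2 == u) && (x.1 k' == w))).
  apply.
  - by move=> z; exact: law_ge0.
  - move=> y; rewrite puE (partition_big (fun x : outcomes s => x.1 k') predT)//=.
    apply: eq_bigr => v _; rewrite pjE; apply: eq_bigl => x.
    by rewrite xpair_eqE andbC.
  - under eq_bigr do rewrite puE.
    rewrite -(sum_law (pr s) mX).
    by rewrite [RHS](partition_big (fun x : outcomes s => restr (A k) x.2) predT).
by move=> x /=; rewrite xpair_eqE andbC.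
Qed.

Lemma messages_law (R : realType) (q M K N : nat) (A : 'I_K -> {set 'I_N})
    (s : dmuss_scheme R q M A) (S : {set 'I_K}) (d : forall k, msg s k) :
  (0 < q)%N ->
  \sum_(x : outcomes s | [forall k in S, x.1 k == d k])
     law (pr s) (@outcome _ _ _ _ _ _ s) x =
  \prod_(k in S) #|msg s k|%:R^-1.
Proof.
move=> q0; set p := law _ _; have mX := @outcome_rv _ _ _ _ _ _ s.
have lawE w : \sum_(x : outcomes s | x.1 == w) p x = \prod_k #|msg s k|%:R^-1.
  rewrite -(law_comp (pr s) (fun x : outcomes s => x.1) w mX).
  under [RHS]eq_bigr => k _ do rewrite -(@message_uniform _ _ _ _ _ _ s k (w k)).
  rewrite -(@message_indep _ _ _ _ _ _ s (fun k => w k)) /law; congr (fine (pr s _)).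
  apply/seteqP; split => z /=.
    by move=> <-; apply: functional_extensionality_dep => k; rewrite ffunE.
  move=> wE; apply/ffunP => k; rewrite ffunE.
  exact: (congr1 (fun f : forall k, msg s k => f k) wE).
rewrite (partition_big (fun x : outcomes s => x.1)
  (fun w => [forall k in S, w k == d k]))//=.
(* Messages outside [S] range freely, and the number of their values cancels their factors. *)
pose E k := if k \in S then [set d k]%SET else [set: msg s k]%SET.
transitivity (\sum_(w in setXn E) \prod_k #|msg s k|%:R^-1 : R).
  apply: eq_big => [w|w wS].
    apply/forallP/setXnP => H k; have := H k; rewrite /E; case: ifP => kS; rewrite !inE//=.
  rewrite -(lawE w); apply: eq_bigl => x; case: eqP => [->|]; last by rewrite andbF.
  by rewrite wS.
rewrite sumr_const cardsXn -mulr_natr natr_prod -big_split /= [RHS]big_mkcond.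
apply: eq_bigr => k _; rewrite /E; case: ifP => kS; first by rewrite cards1 mulr1.
by rewrite cardsT mulVf// pnatr_eq0 -lt0n card_msg_gt0.
Qed.

(** A success probability of 1/2 costs a factor 2 <= q, hence one symbol in the exponent. This
    excess vanishes once divided by the storage size. *)
Lemma pow_bound (R : realType) (q a b : nat) (P : R) :
  (1 < q)%N -> 2^-1 <= P -> P <= (q ^ b)%:R^-1 * (q ^ a)%:R -> (b <= a.+1)%N.
Proof.
move=> q1 P2 PE; rewrite -(leq_exp2l _ _ q1) expnS -(ler_nat R) natrM.
have qb : 0 < (q ^ b)%:R :> R by rewrite ltr0n expn_gt0 ltnW.
have := le_trans P2 PE; rewrite mulrC ler_pdivlMr// => H.
have : 2 * (2^-1 * (q ^ b)%:R) <= q%:R * (q ^ a)%:R :> R.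
  by rewrite ler_pM// ?mulr_ge0// ?invr_ge0// ler_nat.
by rewrite mulrA divff ?mul1r// pnatr_eq0.
Qed.

Lemma converse_privacy (R : realType) (q M K N : nat) (A : 'I_K -> {set 'I_N})
    (s : dmuss_scheme R q M A) (k k' : 'I_K) :
  (1 < q)%N -> is_private s -> k != k' ->
  (pr s [set o | message s k o <> estimate k o] <= (2^-1)%:E)%E ->
  (msg_len s k <= (M * #|A k :\: A k'|).+1)%N.
Proof.
move=> q1 priv neq_kk'; rewrite prob_error lee_fin; set p := law _ _ => err.
have mX := @outcome_rv _ _ _ _ _ _ s.
have p0 x : 0 <= p x by exact: law_ge0.
have p1 : \sum_x p x = 1 := sum_law (pr s) mX.
apply: (@pow_bound R q _ _ (\sum_(x | decodes k x) p x)) => //.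
  move: p1; rewrite (bigID (decodes k)) /=; lra.
(* Given [u] on [A k'], the guess supplies [v] on the rest of [A k] and runs the decoder on the
   combined reading. *)
pose D u v (x : outcomes s) :=
  x.1 k == decode s k (restr (A k)
    [ffun n => if n \in A k' then @extend N (node s) (A k') u n
               else @extend N (node s) (A k :\: A k') v n]).
have := @guess_bound R _ _ _ p (fun x : outcomes s => restr (A k') x.2)
  (fun x : outcomes s => restr (A k :\: A k') x.2) D (#|msg s k|%:R^-1) p0 p1.
rewrite card_restr card_node card_msg -expnM.
have DE : (fun x : outcomes s => D (restr (A k') x.2) (restr (A k :\: A k') x.2) x)
    =1 decodes k.
  move=> x; rewrite /D /decodes; congr (_ == decode s k _); apply/ffunP => n.
  rewrite !ffunE; case: ifP => nA; rewrite extend_restr// inE nA.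
  exact: (valP n).
rewrite (eq_bigl _ _ DE); apply=> u v.
by rewrite private_law 1?eq_sym// mulrC card_msg.
Qed.

Lemma converse_sum (R : realType) (q M K N : nat) (A : 'I_K -> {set 'I_N})
    (s : dmuss_scheme R q M A) (S : {set 'I_K}) :
  (1 < q)%N ->
  (\sum_(k in S) pr s [set o | message s k o <> estimate k o] <= (2^-1)%:E)%E ->
  (\sum_(k in S) msg_len s k <= (M * #|(\bigcup_(k in S) A k)%SET|).+1)%N.
Proof.
move=> q1; rewrite (eq_bigr _ (fun k _ => prob_error s k)).
rewrite sumEFin lee_fin; set p := law _ _ => err.
have mX := @outcome_rv _ _ _ _ _ _ s.
have p0 x : 0 <= p x by exact: law_ge0.
have p1 : \sum_x p x = 1 := sum_law (pr s) mX.
apply: (@pow_bound R q _ _ (\sum_(x | [forall k in S, decodes k x]) p x)) => //.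
  (* Union bound over the users of [S] that may fail. *)
  suff : 1 <= \sum_(x | [forall k in S, decodes k x]) p x +
       \sum_(k in S) \sum_(x | ~~ decodes k x) p x by move: err; lra.
  rewrite -p1 (bigID (fun x => [forall k in S, decodes k x])) /= lerD2l.
  under [leRHS]eq_bigr do rewrite big_mkcond.
  rewrite exchange_big big_mkcond /=; apply: ler_sum => x _.
  have pos : 0 <= \sum_(k in S) (if ~~ decodes k x then p x else 0).
    by apply: sumr_ge0 => k _; case: ifP.
  case: ifP => // /forallPn[k]; rewrite negb_imply => /andP[kS kx].
  rewrite (bigD1 k)//= kx lerDl; apply: sumr_ge0 => j _; by case: ifP.
set UA := (\bigcup_(k in S) A k)%SET.
(* Conditioning on [unit] means that nothing is known beforehand, so the bound per guess is the a
   priori probability of one tuple of messages of [S]. *)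
pose D (u : unit) v (x : outcomes s) :=
  [forall k in S, x.1 k == decode s k (restr (A k) [ffun n => @extend N (node s) UA v n])].
have := @guess_bound R _ _ _ p (fun x : outcomes s => tt)
  (fun x : outcomes s => restr UA x.2) D
  (\prod_(k in S) #|msg s k|%:R^-1) p0 p1.
rewrite card_restr card_node -expnM.
have DE : (fun x : outcomes s => D tt (restr UA x.2) x)
    =1 (fun x => [forall k in S, decodes k x]).
  move=> x; rewrite /D /decodes; apply: eq_forallb_in => k kS.
  congr (_ == decode s k _); apply/ffunP => n.
  rewrite !ffunE extend_restr//; apply/bigcupP; exists k => //; exact: (valP n).
have prodE : \prod_(k in S) #|msg s k|%:R^-1 =
    (q ^ (\sum_(k in S) msg_len s k))%:R^-1 :> R.
  by rewrite expn_sum natr_prod -prodfV; apply: eq_bigr => k _; rewrite card_msg.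
rewrite (eq_bigl _ _ DE) prodE; apply=> -[] v.
rewrite [X in _ * X](_ : _ = 1) ?mulr1; last by rewrite -p1; apply: eq_bigl.
rewrite (eq_bigl (fun x : outcomes s => [forall k in S,
  x.1 k == decode s k (restr (A k) [ffun n => @extend N (node s) UA v n])]))//.
by rewrite (messages_law S (fun k => decode s k _)) ?(ltnW q1)// prodE.
Qed.

(** * Schemes from codes *)

(** A separate name, so that the discrete sigma-algebra is attached to the alias and [V] itself
    stays purely algebraic. *)
Definition discrete_space (V : finZmodType) : Type := V.
HB.instance Definition _ (V : finZmodType) := Finite.on (discrete_space V).
HB.instance Definition _ (V : finZmodType) :=
  isPointed.Build (discrete_space V) (0 : V).
HB.instance Definition _ (V : finZmodType) :=
  @isMeasurable.Build default_measure_display (discrete_space V)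
    discrete_measurable discrete_measurable0
    discrete_measurableC discrete_measurableU.

(** Written as a scaled sum of Dirac masses, so that sigma-additivity is inherited. *)
Definition uniform_measure (R : realType) (V : finZmodType) :
    set (discrete_space V) -> \bar R :=
  mscale (#|V|%:R^-1)%:nng
    (msum (fun i => \d_(nth (0 : V) (enum V) i : discrete_space V)) #|V|).

HB.instance Definition _ (R : realType) (V : finZmodType) :=
  Measure.on (@uniform_measure R V).

Lemma uniform_measureE (R : realType) (V : finZmodType) (S : set V) :
  @uniform_measure R V S = (#|[pred v : V | v \in S]|%:R / #|V|%:R)%:E.
Proof.
rewrite /uniform_measure /mscale /= /msum.
under eq_bigr do rewrite /= diracE.
rewrite sumEFin -EFinM mulrC; congr (_ / _)%:E.
rewrite -(big_mkord predT (fun i => (nth (0 : V) (enum V) i \in S)%:R)) cardE.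
rewrite -(big_nth (0 : V) predT (fun v => (v \in S)%:R)) big_enum /=.
by rewrite -natr_sum -sum1_card [in RHS]big_mkcond.
Qed.

Lemma uniform_measureT (R : realType) (V : finZmodType) :
  @uniform_measure R V setT = 1%E.
Proof.
rewrite uniform_measureE (eq_card (_ : _ =i V)); last first.
  by move=> v; rewrite !inE; apply/asboolP.
by rewrite divff// pnatr_eq0 -lt0n; apply/card_gt0P; exists 0.
Qed.

HB.instance Definition _ (R : realType) (V : finZmodType) :=
  Measure_isProbability.Build _ _ _ (@uniform_measure R V)
    (uniform_measureT R V).

(** Translation by [u] maps the part of one fibre in [B] injectively into that of another, so all
    fibres meet [B] equally often. In terms of probability, [f] is uniform and independent of the
    event [B]. *)
Lemma translation_equidistributed (V : finZmodType) (W : finType)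
    (f : V -> W) (B : pred V) :
  (forall w w', exists u, forall Y, f Y = w ->
     f (Y + u) = w' /\ B (Y + u) = B Y) ->
  forall w, (#|[pred Y | (f Y == w) && B Y]| * #|W|)%N = #|B|.
Proof.
move=> trans w.
have le_card w1 w2 :
    (#|[pred Y | (f Y == w1) && B Y]| <= #|[pred Y | (f Y == w2) && B Y]|)%N.
  have [u uP] := trans w1 w2.
  rewrite -(card_imset _ (@addIr _ u)) fintype.subset_leq_card//.
  apply/fintype.subsetP => Y' /imsetP[Y]; rewrite !inE => /andP[/eqP fY BY] ->.
  by have [-> ->] := uP Y fY; rewrite eqxx.
rewrite -[RHS]sum1_card (partition_big f predT)//=.
rewrite mulnC -sum_nat_const; apply: eq_bigr => w' _.
rewrite sum1_card; apply/eqP; rewrite eqn_leq; apply/andP; split.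
  rewrite (leq_trans (le_card _ w'))// fintype.subset_leq_card//.
  by apply/fintype.subsetP => Y; rewrite !inE unfold_in andbC.
rewrite (leq_trans _ (le_card w' w))// fintype.subset_leq_card//.
by apply/fintype.subsetP => Y; rewrite !inE unfold_in andbC.
Qed.

Lemma translation_uniform (V : finZmodType) (W : finType) (f : V -> W) :
  (forall w w', exists u, forall Y, f Y = w -> f (Y + u) = w') ->
  forall w, (#|[pred Y | f Y == w]| * #|W|)%N = #|V|.
Proof.
move=> trans w; transitivity #|@predT V|; last exact: eq_card.
rewrite -(@translation_equidistributed _ _ f predT _ w).
  by congr (_ * _)%N; apply: eq_card => Y; rewrite !inE andbT.
by move=> w1 w2; have [u uP] := trans w1 w2; exists u => Y /uP.
Qed.

Lemma natr_ratio (R : realType) (a b c : nat) :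
  (0 < b)%N -> (a * b)%N = c -> a%:R = c%:R / b%:R :> R.
Proof. by move=> b0 <-; rewrite natrM mulfK// pnatr_eq0 -lt0n. Qed.

Lemma card_le_cancel (X Y : finType) :
  (0 < #|X|)%N -> (#|X| <= #|Y|)%N ->
  exists (f : X -> Y) (g : Y -> X), cancel f g.
Proof.
move=> /card_gt0P[x0 _] leXY.
pose f x : Y := enum_val (widen_ord leXY (enum_rank x)).
have inj_f : injective f.
  move=> x y /enum_val_inj/(congr1 val)/= /ord_inj; exact: enum_rank_inj.
exists f, (fun y => odflt x0 [pick x | f x == y]) => x.
by case: pickP => [y /eqP/inj_f//|/(_ x)]; rewrite eqxx.
Qed.

(* The sample space is the uniformly distributed content [Y] of the storage; the
   messages are linear functions of [Y] and the private randomness is the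
   component of [Y] in the common kernel of these functions. *)
Lemma scheme_of_code (R : realType) (q L M T K N : nat) (A : 'I_K -> {set 'I_N})
    (E F : finFieldType) (rho : 'I_K -> nat)
    (G : forall k, 'M[E]_(#|{: 'I_N * 'I_T}|, rho k))
    (H : forall k, 'M[E]_(rho k, #|{: 'I_N * 'I_T}|)) :
  (1 < q)%N -> #|E| = (q ^ L)%N -> #|F| = (q ^ M)%N -> (L * T <= M)%N ->
  secret_sharing_code (fun k => [set v | (enum_val v).1 \in A k]%SET) G H ->
  exists s : dmuss_scheme R q M A,
    [/\ forall k, msg_len s k = (L * rho k)%N,
        forall k, pr s [set o | message s k o <> estimate k o] = 0%E
      & is_private s].
Proof.
move=> q1 cardE_ cardF leLTM [suppG HG1 HG0 privG].
set n := #|_| in G H suppG HG1 HG0 privG.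
(* [phi] packs [T] symbols of [E] into one node, which has room for them because [L * T <= M]. *)
have [phi [psi phiK]] : exists (f : 'rV[E]_T -> F) (g : F -> 'rV[E]_T), cancel f g.
  apply: card_le_cancel; first by apply/card_gt0P; exists 0.
  by rewrite card_mx mul1n cardE_ cardF -expnM leq_exp2l.
pose V : finZmodType := 'rV[E]_n.
pose msgT k : finType := 'rV[E]_(rho k).
have card_msgT k : #|msgT k| = (q ^ (L * rho k))%N.
  by rewrite /msgT card_mx mul1n cardE_ -expnM.
have msgT0 k : (0 < #|msgT k|)%N by rewrite card_msgT expn_gt0 ltnW.
pose P : probability (discrete_space V) R := @uniform_measure R V.
pose m k (Y : V) : msgT k := Y *m G k.
pose lift_ (w : forall k, msgT k) : V := \sum_k w k *m H k.
have lift_G w k : lift_ w *m G k = w k.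
  rewrite mulmx_suml (bigD1 k)//= -mulmxA HG1 mulmx1 big1 ?addr0// => k' neq.
  by rewrite -mulmxA HG0// mulmx0.
pose Z (Y : V) : V := Y - lift_ (m ^~ Y).
pose content (Y : V) : {ffun 'I_N -> F} :=
  [ffun i => phi (\row_t Y 0 (enum_rank (i, t)))].
pose enc (w : forall k, msgT k) (z : V) := content (lift_ w + z).
pose dec k (y : {ffun {i : 'I_N | i \in A k} -> F}) : msgT k :=
  (\row_v psi (extend y (enum_val v).1) 0 (enum_val v).2) *m G k.
have V0 : #|V|%:R != 0 :> R by rewrite pnatr_eq0 -lt0n; apply/card_gt0P; exists 0.
have lawE (U : finType) (X : V -> U) u :
    law P X u = #|[pred Y | X Y == u]|%:R / #|V|%:R.
  rewrite /law /P /= uniform_measureE /=; congr (_%:R / _); apply: eq_card => Y.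
  by rewrite !inE; apply/asboolP/eqP.
(* Adding [lift_ w] shifts the messages by [w] and fixes [Z], so events on [Z] have the invariance
   that [equi_all] asks for. *)
have shift_msgs (w : forall k, msgT k) Y :
    (m ^~ (Y + lift_ w) = fun k => m k Y + w k) /\ Z (Y + lift_ w) = Z Y.
  have mE : m ^~ (Y + lift_ w) = fun k => m k Y + w k.
    by apply: functional_extensionality_dep => k; rewrite /m mulmxDl lift_G.
  split=> //; rewrite /Z mE.
  have -> : lift_ (fun k => m k Y + w k) = lift_ (m ^~ Y) + lift_ w.
    by rewrite /lift_ -big_split; apply: eq_bigr => k _; rewrite mulmxDl.
  by rewrite opprD addrACA subrr addr0.
pose mall (Y : V) : {dffun forall k, msgT k} := [ffun k => m k Y].
have equi_all (B : pred V) w : (forall x Y, B (Y + lift_ x) = B Y) ->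
    (#|[pred Y | (mall Y == w) && B Y]| * \prod_k #|msgT k|)%N = #|B|.
  move=> BP; rewrite -(@translation_equidistributed V _ mall B _ w).
    congr (_ * _)%N; rewrite -[RHS]cardsT.
    have -> : [set: {dffun forall k, msgT k}]%SET = setXn (fun k => [set: msgT k]%SET).
      by apply/setP => x; rewrite inE; apply/esym/setXnP => k; rewrite inE.
    by rewrite cardsXn; apply: eq_bigr => k _; rewrite cardsT.
  move=> w1 w2; exists (lift_ (fun k => w2 k - w1 k)) => Y mY; split=> //.
  apply/ffunP => k; rewrite ffunE /m mulmxDl lift_G.
  have /(congr1 (fun x : {dffun forall k, msgT k} => x k)) := mY.
  by rewrite ffunE /m => ->; rewrite addrC subrK.
have law_msg k w : law P (m k) w = #|msgT k|%:R^-1.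
  rewrite lawE; apply: (mulIf V0); rewrite divfK// mulrC.
  apply: natr_ratio; first exact: msgT0.
  apply: translation_uniform => w1 w2; exists ((w2 - w1) *m H k) => Y mY.
  by rewrite /m mulmxDl -mulmxA HG1 mulmx1 -/(m k Y) mY addrC subrK.
pose c := (\prod_k #|msgT k|)%N.
have c0 : (0 < c)%N by rewrite prodn_gt0.
have mallE (x : forall k, msgT k) :
    [set Y : V | m ^~ Y = x] = [set Y | mall Y = [ffun k => x k]].
  apply/seteqP; split => Y /= [].
    by move=> <-; apply/ffunP => k; rewrite !ffunE.
  move=> mY; apply: functional_extensionality_dep => k.
  by have := congr1 (fun x : {dffun forall k, msgT k} => x k) mY; rewrite !ffunE.
have law_all w : law P mall w = c%:R^-1.
  rewrite lawE; apply: (mulIf V0); rewrite divfK// mulrC.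
  apply: natr_ratio => //; transitivity #|@predT V|; last exact: eq_card.
  rewrite -(equi_all predT w)//; congr (_ * _)%N; apply: eq_card => Y.
  by rewrite !inE andbT.
have indep : mutually_independent P m.
  move=> x; rewrite [LHS]/law (_ : _ @^-1` _ = [set Y | m ^~ Y = x])// mallE.
  rewrite -/(law P mall _) law_all /c natr_prod -prodfV.
  by apply: eq_bigr => k _; rewrite law_msg.
have seed_ind : @independent_of_messages _ (discrete_space V) R P K msgT m
    _ (discrete_space V) Z.
  move=> x B _; rewrite mallE.
  have -> : P [set Y | mall Y = [ffun k => x k]] = (c%:R^-1)%:E.
    by rewrite -(law_all [ffun k => x k]) /law fineK// fin_num_measure.
  rewrite /P /= !uniform_measureE -EFinM [in RHS]mulrA [in RHS](mulrC c%:R^-1).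
  congr (_ / _)%:E; apply: (natr_ratio _ c0).
  pose BZ Y := Z Y \in B.
  transitivity #|BZ|; last by apply: eq_card => Y; rewrite !inE.
  rewrite -(equi_all BZ [ffun k => x k]); last first.
    by move=> w Y; rewrite /BZ; have [_ ->] := shift_msgs w Y.
  congr (_ * _)%N; apply: eq_card => Y; rewrite !inE /BZ in_setI.
  by congr (_ && _); apply/asboolP/eqP.
pose s : dmuss_scheme R q M A := @DmussScheme R q M K N A F cardF (fun k => L * rho k)%N
  msgT card_msgT _ (discrete_space V) P m (fun _ _ => I) law_msg indep
  _ (discrete_space V) Z (fun _ _ _ => I) seed_ind enc (fun _ _ => I) dec.
have storageE Y : @storage _ _ _ _ _ _ s Y = content Y.
  by rewrite /storage /= /enc /Z addrC subrK.
have accessedE k : accessed (s := s) k = (fun Y : V => restr (A k) (content Y)).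
  by apply/funext => Y; rewrite /accessed storageE.
exists s; split=> //.
- move=> k; rewrite (_ : [set o | _] = set0) ?measure0//.
  apply/seteqP; split => // Y /= []; rewrite /estimate accessedE /= /dec /m.
  apply/matrixP => i j; rewrite !mxE; apply: eq_bigr => v _; rewrite mxE.
  (* Outside [A k] the value read back may be wrong, but the rows of [G k] vanish there. *)
  case vA: ((enum_val v).1 \in A k); last first.
    by rewrite suppG ?mulr0// inE vA.
  rewrite extend_restr// ffunE phiK mxE; congr (Y _ _ * _).
    by rewrite ord1.
  by rewrite -surjective_pairing enum_valK.
- move=> k k' neq_kk'; rewrite entropy_message ?(ltnW q1)//.
  apply: cond_entropy_uniform; first exact: msgT0.
    exact: (@sum_law _ (discrete_space V) R P _ (accessed (s := s) k) (fun _ => I)).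
  move=> w y; rewrite !lawE accessedE.
  rewrite mulrAC; congr (_ / _); apply: natr_ratio; first exact: msgT0.
  rewrite -(@translation_equidistributed V _ (m k')
    (fun Y => restr (A k) (content Y) == y) _ w).
    by congr (_ * _)%N.
  (* Translation along [X] changes message [k'] at will and fixes every coordinate that user [k]
     reads. *)
  have [|X X0 XG] := privG k' k; first by rewrite eq_sym.
  move=> w1 w2; exists ((w2 - w1) *m X) => Y mY; split.
    by rewrite /m mulmxDl -mulmxA XG mulmx1 -/(m k' Y) mY addrC subrK.
  congr (_ == y); apply/ffunP => i; rewrite !ffunE; congr (phi _).
  apply/rowP => t; rewrite !mxE big1 ?addr0// => j _; rewrite X0 ?mulr0//.
  by rewrite inE enum_rankK; exact: (valP i).
Qed.

(** * The capacity region *)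

Lemma is_prime_power_gt1 (q : nat) : is_prime_power q -> (1 < q)%N.
Proof.
move=> [p [e [pp e0 ->]]]; rewrite -(expn0 p) ltn_exp2l//; exact: prime_gt1.
Qed.

Lemma exists_finField (q L : nat) :
  is_prime_power q -> (0 < L)%N -> exists F : finFieldType, #|F| = (q ^ L)%N.
Proof.
move=> [p [e [pp e0 ->]]] L0.
have [|F _ cardF] := @pPrimePowerField p (e * L) pp; first by rewrite muln_gt0 e0.
by exists F; rewrite cardF expnM.
Qed.

Lemma rate_constraintsP (R : realType) (K N : nat) (A : 'I_K -> {set 'I_N})
    (r : 'rV[R]_K) :
  rate_constraints A r <-> [/\ forall k, 0 <= r 0 k,
    forall k k', k != k' -> r 0 k <= #|A k :\: A k'|%:R
  & forall S : {set 'I_K}, \sum_(i in S) r 0 i <= #|(\bigcup_(i in S) A i)%SET|%:R].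
Proof.
split=> -[r0 rA rS]; split=> //.
  move=> k k' neq; have /bigmin_geP[_ /(_ k')] := rA k.
  by rewrite eq_sym neq lee_fin; apply.
move=> k; apply/bigmin_geP; split; first exact: leey.
by move=> k' neq; rewrite lee_fin rA// eq_sym.
Qed.

Lemma rate_constraints_conv (R : realType) (K N : nat)
    (A : 'I_K -> {set 'I_N}) (t : R) (u v : 'rV[R]_K) :
  0 <= t <= 1 -> rate_constraints A u -> rate_constraints A v ->
  rate_constraints A (t *: u + (1 - t) *: v).
Proof.
move=> /andP[t0 t1] /rate_constraintsP[u0 uA uS] /rate_constraintsP[v0 vA vS].
have t1' : 0 <= 1 - t by rewrite subr_ge0.
have conv_bound (a b c : R) : a <= c -> b <= c -> t * a + (1 - t) * b <= c.
  move=> ac bc; have := lerD (ler_wpM2l t0 ac) (ler_wpM2l t1' bc).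
  by rewrite -mulrDl [t + _]addrC subrK mul1r.
apply/rate_constraintsP; split=> [k|k k' neq|S].
- by rewrite !mxE addr_ge0// mulr_ge0.
- by rewrite !mxE conv_bound ?uA ?vA.
- under [leLHS]eq_bigr do rewrite !mxE.
  by rewrite big_split /= -!mulr_sumr conv_bound ?uS ?vS.
Qed.

Lemma convex_hull_rate_constraints (R : realType) (K N : nat)
    (A : 'I_K -> {set 'I_N}) :
  convex_hull (@rate_constraints R K N A) = rate_constraints A.
Proof.
apply: smallest_id => u v l; rewrite !inE; apply: rate_constraints_conv.
by apply/andP; split.
Qed.

Lemma closure_rate_constraints (R : realType) (K N : nat)
    (A : 'I_K -> {set 'I_N}) (r : 'rV[R]_K) :
  closure (rate_constraints A) r -> rate_constraints A r.
Proof.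
move=> clr.
have approx e : 0 < e -> exists x : 'rV[R]_K,
    rate_constraints A x /\ forall k, `|r 0 k - x 0 k| < e.
  move=> e0; have [x [xA [_ rx]]] := clr _ (nbhsx_ballx r e e0).
  by exists x; split=> // k; exact: rx.
apply/rate_constraintsP; split=> [k|k k' neq|S].
- apply/ler_addgt0Pr => e /approx[x [/rate_constraintsP[x0 _ _] /(_ k)]].
  by rewrite ltr_norml => /andP[]; have := x0 k; lra.
- apply/ler_addgt0Pr => e /approx[x [/rate_constraintsP[_ /(_ _ _ neq) xA _] /(_ k)]].
  by rewrite ltr_norml => /andP[]; lra.
(* The tolerance is shared among at most [K] summands; [K.+1] keeps [d] positive also for
   [K = 0]. *)
- apply/ler_addgt0Pr => e e0; pose d := e / K.+1%:R.
  have d0 : 0 < d by rewrite divr_gt0.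
  have [x [/rate_constraintsP[_ _ /(_ S) xS] rx]] := approx d d0.
  apply: (@le_trans _ _ (\sum_(i in S) (x 0 i + d))).
    by apply: ler_sum => i _; have := rx i; rewrite ltr_norml => /andP[_]; lra.
  rewrite big_split /= lerD// sumr_const.
  rewrite (@le_trans _ _ (d *+ K.+1))//.
    rewrite ler_wpMn2l ?(ltW d0)//; apply: leqW.
    by rewrite (leq_trans (max_card _))// card_ord.
  by rewrite /d -mulr_natr divfK.
Qed.

Lemma cvg_sumr (R : realType) (I : finType) (S : pred I) (f : I -> nat -> R)
    (l : I -> R) :
  (forall i, f i m @[m --> \oo] --> l i) ->
  (\sum_(i | S i) f i m) @[m --> \oo] --> \sum_(i | S i) l i.
Proof.
move=> fl; elim: (index_enum I) => [|i s IH].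
  by under eq_cvg do rewrite big_nil; rewrite big_nil; exact: cvg_cst.
under eq_cvg do rewrite big_cons; rewrite big_cons.
by case: (S i) => //; exact: cvgD.
Qed.

Lemma achievable_rate_constraints (R : realType) (q K N : nat)
    (A : 'I_K -> {set 'I_N}) (r : 'rV[R]_K) :
  (1 < q)%N -> achievable q A r -> rate_constraints A r.
Proof.
move=> q1 [r0 [s [err priv rates]]].
(* This threshold keeps the total error of any coalition at most 1/2, as both converse bounds
   require. *)
have small_err : \forall m \near \oo, forall k,
    (pr (s m) [set o | message (s m) k o <> estimate k o] <= (2^-1 / K.+1%:R)%:E)%E.
  apply: filter_forall => k; have d0 : (0 < (2^-1 / K.+1%:R : R)%:E)%E.
    by rewrite lte_fin divr_gt0.
  have lt_err : \forall m \near \oo,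
      (pr (s m) [set o | message (s m) k o <> estimate k o] < (2^-1 / K.+1%:R)%:E)%E.
    exact: err k _ (open_ereal_lt' d0).
  by apply: filterS lt_err => m /ltW.
(* The extra symbol in the converse bounds contributes [harmonic m], which tends to 0. *)
have limit_bound (f : nat -> nat) (a : nat) (l : R) :
    ((f m)%:R / m.+1%:R : R) @[m --> \oo] --> l ->
    (\forall m \near \oo, (f m <= (m.+1 * a).+1)%N) -> l <= a%:R.
  move=> fl fa; have gl : a%:R + harmonic m @[m --> \oo] --> (a%:R + 0 : R).
    by apply: cvgD; [exact: cvg_cst|exact: cvg_harmonic].
  rewrite -[leRHS]addr0; apply: ler_cvg_to fl gl _.
  apply: filterS fa => m fm; rewrite /harmonic ler_pdivrMr//.
  rewrite mulrDl mulVf// -natrM -[1]/(1%:R) -natrD ler_nat.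
  by rewrite addn1 mulnC.
apply/rate_constraintsP; split=> // [k k' neq|S].
- apply: limit_bound (rates k) _; apply: filterS small_err => m /(_ k) km.
  apply: (converse_privacy q1 (priv m) neq); apply: le_trans km _.
  by rewrite lee_fin ler_pdivrMr// ler_peMr// ler1n.
- apply: (limit_bound (fun m => \sum_(k in S) msg_len (s m) k)%N).
    under eq_cvg do rewrite natr_sum mulr_suml.
    exact: cvg_sumr.
  apply: filterS small_err => m km; apply: converse_sum => //.
  apply: (@le_trans _ _ (\sum_(k in S) (2^-1 / K.+1%:R)%:E)%E).
    by apply: lee_sum => k _; exact: km.
  rewrite sumEFin lee_fin sumr_const -[leLHS]mulr_natr mulrAC ler_pdivrMr//.
  rewrite ler_wpM2l// ler_nat; apply: leqW.
  by rewrite (leq_trans (max_card _))// card_ord.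
Qed.

Lemma card_node_symbols (N T : nat) (S : {set 'I_N}) :
  #|[set v : 'I_#|{: 'I_N * 'I_T}| | (enum_val v).1 \in S]%SET| = (#|S| * T)%N.
Proof.
rewrite -(card_imset _ (@enum_val_inj _ _)) -[T in RHS]card_ord -(cardsT 'I_T) -cardsX.
congr #|pred_of_set _|; apply/setP => -[i t]; rewrite inE inE andbT.
apply/imsetP/idP => [[v]|iS]; first by rewrite inE => vS Ev; rewrite -Ev in vS.
by exists (enum_rank (i, t)); rewrite ?inE enum_rankK.
Qed.

(** With all messages of length 0 nothing can fail or leak. Such schemes fill the storage sizes that
    are too small for a generic code. *)
Lemma trivial_scheme (R : realType) (q M K N : nat) (A : 'I_K -> {set 'I_N}) :
  is_prime_power q -> (0 < M)%N ->
  exists s : dmuss_scheme R q M A,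
    (forall k, pr s [set o | message s k o <> estimate k o] = 0%E) /\ is_private s.
Proof.
move=> hq M0; have [F cardF] := exists_finField hq M0.
have [||s [_ serr spriv]] := @scheme_of_code R q M M 0 K N A F F (fun=> 0%N)
    (fun k => 0) (fun k => 0) (is_prime_power_gt1 hq) cardF cardF.
- by rewrite muln0.
- split=> [k v j|k|k k' _|k k' _]; first by rewrite mxE.
  + by apply/matrixP => -[].
  + by apply/matrixP => -[].
  + by exists 0 => [j v|]; [rewrite mxE|apply/matrixP => -[]].
- by exists s.
Qed.

(** With [T] fixed and [m] growing, the field of size [q ^ (m.+1 %/ T)] eventually exceeds the
    threshold of [generic_code], and the rounding in [m.+1 %/ T] costs a vanishing rate. *)
Lemma achievable_fraction (R : realType) (q K N T : nat)
    (A : 'I_K -> {set 'I_N}) (rho : 'I_K -> nat) :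
  is_prime_power q -> (0 < T)%N ->
  (forall k k', k != k' -> (rho k <= #|A k :\: A k'| * T)%N) ->
  (forall S : {set 'I_K},
    (\sum_(k in S) rho k <= #|(\bigcup_(k in S) A k)%SET| * T)%N) ->
  achievable q A (\row_k ((rho k)%:R / T%:R : R)).
Proof.
move=> hq T0 rhoA rhoS; have q1 := is_prime_power_gt1 hq.
pose B k := [set v : 'I_#|{: 'I_N * 'I_T}| | (enum_val v).1 \in A k]%SET.
have [||c codeE] := @generic_code K _ B rho.
- move=> k k' neq; apply: leq_trans (rhoA _ _ neq) _.
  rewrite -card_node_symbols fintype.subset_leq_card//.
  by apply/fintype.subsetP => v; rewrite !inE.
- move=> S; apply: leq_trans (rhoS S) _.
  rewrite -card_node_symbols fintype.subset_leq_card//.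
  apply/fintype.subsetP => v; rewrite inE => /bigcupP[k kS vk].
  by apply/bigcupP; exists k; rewrite // inE.
have schemes m : {s : dmuss_scheme R q m.+1 A |
    [/\ forall k, pr s [set o | message s k o <> estimate k o] = 0%E, is_private s
      & (c.+1 * T <= m)%N -> forall k, msg_len s k = ((m.+1 %/ T) * rho k)%N]}.
  apply: cid; have [cTm|ltm] := leqP (c.+1 * T)%N m; last first.
    have [s [serr spriv]] := @trivial_scheme R q m.+1 K N A hq isT.
    by exists s.
  (* The exponent alone exceeds [c], hence so does the field size, by q^L > L. *)
  have Lc : (c < m.+1 %/ T)%N by rewrite leq_divRL// leqW.
  have [E cardE_] := exists_finField hq (leq_ltn_trans (leq0n c) Lc).
  have [F cardF] := exists_finField hq (ltn0Sn m).
  have [|G [H GH]] := codeE E.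
    by rewrite cardE_ (ltn_trans Lc)// ltn_expl.
  have [|s [slen serr spriv]] := scheme_of_code R q1 cardE_ cardF _ GH.
    exact: leq_trunc_div.
  by exists s.
split; first by move=> k; rewrite mxE divr_ge0.
exists (fun m => projT1 (schemes m)); split.
- move=> k; rewrite (_ : (fun m => _) = fun=> 0%E); first exact: cvg_cst.
  by apply/funext => m; case: (schemes m) => s [].
- by move=> m; case: (schemes m) => s [].
- move=> k; rewrite mxE.
  (* Since [(m.+1 %/ T + 1) * T >= m.+1], rounding down loses at most [(rho k)%:R * harmonic m] of
     rate. *)
  pose f (m : nat) : R := (rho k)%:R / T%:R - (rho k)%:R * harmonic m.
  have lenE m : (c.+1 * T <= m)%N ->
      msg_len (projT1 (schemes m)) k = ((m.+1 %/ T) * rho k)%N.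
    by case: (schemes m) => s [] /= _ _ H /H.
  apply: (@squeeze_cvgr _ _ _ _ f (fun=> (rho k)%:R / T%:R)); last exact: cvg_cst.
    near=> m; rewrite lenE; last by near: m; exact: nbhs_infty_ge.
    have T0' : 0 < T%:R :> R by rewrite ltr0n.
    rewrite /f /harmonic natrM; set L : R := (m.+1 %/ T)%:R.
    have M0 : 0 < m.+1%:R :> R by rewrite ltr0n.
    have LT : L * T%:R <= m.+1%:R by rewrite -natrM ler_nat leq_trunc_div.
    have ltM : m.+1%:R <= (L + 1) * T%:R.
      by rewrite /L natr1 -natrM ler_nat; apply/ltnW/ltn_ceil.
    have rk : 0 <= (rho k)%:R :> R by [].
    apply/andP; split.
      rewrite lerBlDr -mulrDl ler_pdivrMr// mulrAC ler_pdivlMr//.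
      rewrite -[(rho k)%:R in X in _ <= (_ + X) * _]mul1r -mulrDl mulrAC mulrC.
      by rewrite ler_wpM2r.
    rewrite ler_pdivrMr// mulrAC ler_pdivlMr// [in leRHS]mulrC.
    by rewrite mulrAC ler_wpM2r.
  rewrite -[X in _ --> X]subr0; apply: cvgB; first exact: cvg_cst.
  rewrite -(mulr0 (rho k)%:R); apply: cvgM; [exact: cvg_cst|exact: cvg_harmonic].
Unshelve. all: by end_near.
Qed.

(** Rates are rounded down to multiples of 1/T with 1/T < e. Rounding down preserves the
    constraints, which become inequalities between integers after scaling by [T]. *)
Lemma rate_constraints_closure (R : realType) (q K N : nat)
    (A : 'I_K -> {set 'I_N}) (r : 'rV[R]_K) :
  is_prime_power q -> rate_constraints A r -> capacity_region q A r.
Proof.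
move=> hq /rate_constraintsP[r0 rA rS] U /nbhs_ballP[e /= e0 ballU].
pose T := (Num.bound e^-1).+1; have T0 : 0 < T%:R :> R by rewrite ltr0n.
have Te : T%:R^-1 < e.
  rewrite -[e]invrK ltf_pV2 ?posrE ?invr_gt0//.
  apply: lt_trans (archi_boundP _) _; first by rewrite invr_ge0 ltW.
  by rewrite ltr_nat.
pose rho k := Num.truncn (r 0 k * T%:R).
have rhoP k : (rho k)%:R <= r 0 k * T%:R < (rho k).+1%:R.
  by apply: truncn_itv; rewrite mulr_ge0.
exists (\row_k ((rho k)%:R / T%:R)); split.
  apply: achievable_fraction => // [k k' neq|S].
    rewrite -(ler_nat R) natrM; have /andP[rk _] := rhoP k.
    by apply: le_trans rk _; rewrite ler_wpM2r// rA.
  rewrite -(ler_nat R) natrM natr_sum.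
  apply: (@le_trans _ _ (\sum_(k in S) r 0 k * T%:R)).
    by apply: ler_sum => k _; have /andP[] := rhoP k.
  by rewrite -mulr_suml ler_wpM2r.
apply: ballU; split=> // i k; rewrite (ord1 i) mxE.
have /andP[rk1 rk2] := rhoP k; rewrite /ball /=.
rewrite ger0_norm ?subr_ge0 ?ler_pdivrMr//; apply: lt_trans Te.
by rewrite ltrBlDl -[X in _ + X]mul1r -mulrDl ltr_pdivlMr// natr1.
Qed.

Theorem theorem1 (R : realType) (q : nat) (hq : is_prime_power q)
    (K N : nat) (A : 'I_K -> {set 'I_N}) :
  @capacity_region R q K N A = convex_hull (@rate_constraints R K N A).
Proof.
rewrite convex_hull_rate_constraints; apply/seteqP; split => r.
  move=> clr; apply: closure_rate_constraints; apply: closure_subset clr => x.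
  exact: achievable_rate_constraints (is_prime_power_gt1 hq).
exact: rate_constraints_closure.
Qed.
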